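(* Let $q$ be an odd prime power and $n$ an even positive integer. If $n\mid (q-1)$, $n<q-1$, and $q\equiv 1\pmod 4$, then there exists a $q$-ary NMDS self-dual code of length $n$.
   Context: A $q$-ary $[n,k,d]$-linear code is a subspace $\mathcal C$ of $\mathbb F_q^n$ (with $\mathbb F_q$ the finite field of $q$ elements) of dimension $k$ and minimum (Hamming) distance $d$; $n$ is its length. Its dual is $\mathcal C^{\bot}=\{b\in\mathbb F_q^n : \sum_{i=1}^n a_ib_i=0 \text{ for all } a\in\mathcal C\}$; $\mathcal C$ is self-dual if $\mathcal C=\mathcal C^{\bot}$. An $[n,k,d]$-linear code is AMDS if $d=n-k$. An AMDS code $\mathcal C$ is NMDS if $\mathcal C^{\bot}$ is also AMDS.
   Formalization: The length n = 2 is excluded, because a self-dual code of length 2 always has dimension 1 and minimum distance 2, not n − k = 1, so it is never NMDS (for example q = 5, n = 2). *)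

(* Defs.v *)
From mathcomp Require Import all_boot all_order all_algebra.

Set Implicit Arguments.
Unset Strict Implicit.
Unset Printing Implicit Defensive.

Import GRing.Theory.
Local Open Scope ring_scope.

Definition prime_power (q : nat) : Prop :=
  exists p m : nat, [/\ prime p, (0 < m)%N & q = (p ^ m)%N].

Section LinearCodes.

Variables (F : finFieldType) (n : nat).
Implicit Types (a b : 'rV[F]_n) (C : {vspace 'rV[F]_n}).

Definition hamming_dist a b : nat := #|[set i : 'I_n | a 0 i != b 0 i]|.

(* A relation rather than a function: no [d] qualifies when [C] is zero. *)
Definition min_distance C (d : nat) : Prop :=
  (exists a b, [/\ a \in C, b \in C, a != b & hamming_dist a b = d])
  /\ (forall a b, a \in C -> b \in C -> a != b -> (d <= hamming_dist a b)%N).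

Definition linear_code C (k d : nat) : Prop :=
  \dim C = k /\ min_distance C d.

Definition dual_set C : {set 'rV[F]_n} :=
  [set b : 'rV[F]_n | [forall a : 'rV[F]_n in C, \sum_i a 0 i * b 0 i == 0]].

(* The span only packages the set as a subspace; it adds no vector, see
   [mem_dual_code]. *)
Definition dual_code C : {vspace 'rV[F]_n} := <<enum (dual_set C)>>%VS.

Definition self_dual C : Prop := C = dual_code C.

Definition AMDS C : Prop :=
  exists k d : nat, linear_code C k d /\ d = (n - k)%N.

Definition NMDS C : Prop := AMDS C /\ AMDS (dual_code C).

Lemma mem_dual_code C b :
  reflect (forall a, a \in C -> \sum_i a 0 i * b 0 i = 0) (b \in dual_code C).
Proof.
have dualP (c : 'rV[F]_n) : reflect (forall a, a \in C -> \sum_i a 0 i * c 0 i = 0)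
                       (c \in dual_set C).
  rewrite inE; apply: (iffP forallP) => [h a aC | h a]; first by apply/eqP/(implyP (h a)).
  by apply/implyP => aC; apply/eqP/h.
apply: (iffP idP) => [bC a aC | h]; last first.
  by apply: memv_span; rewrite mem_enum; apply/dualP.
have := coord_span (X := in_tuple (enum (dual_set C))) bC.
move=> ->; under eq_bigr => i _ do rewrite summxE mulr_sumr.
rewrite exchange_big big1 //= => j _.
have /dualP/(_ a aC) h0 : (enum (dual_set C))`_j \in dual_set C.
  by rewrite -mem_enum mem_nth.
set t := coord _ _ _; transitivity (t * \sum_i a 0 i * (enum (dual_set C))`_j 0 i).
  by rewrite mulr_sumr; apply: eq_bigr => i _; rewrite mxE mulrCA.
by rewrite h0 mulr0.
Qed.

End LinearCodes.

(* Main.v *)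
(* Write n = 2k, so that k > 1, and evaluate polynomials of degree at most k at
   the n-th roots of unity g^i. If the polynomials range over a k-dimensional
   space, every nonzero word has at most k zeros, hence weight at least k = n - k,
   and the code is NMDS self-dual as soon as it is self-orthogonal and some
   nonzero word has k zeros. Orthogonality comes from the vanishing of
   sum_i g^(im) when n does not divide m.
   - If k is odd, then 2n | q - 1 because 4 | q - 1; scaling the coordinates by
     square roots h^i of g^i makes the span of 1, X, .., X^(k-2), X^k
     self-orthogonal, and X^k - 1 has k zeros.
   - If k is even, the span of 1 + eta X^k, X, .., X^(k-1) is self-orthogonal when
     eta^2 = -1. The polynomial prod_(j < k) (X - g^j) has constant term
     P = g^(k(k-1)/2), with P^2 = -1, so it lies in the span for eta = 1/P. *)
Require Import Defs.
From mathcomp Require Import all_boot all_order all_algebra.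
From mathcomp Require Import cyclic finfield zify.

Set Implicit Arguments.
Unset Strict Implicit.
Unset Printing Implicit Defensive.

Import GRing.Theory.
Local Open Scope ring_scope.

(** * Roots of unity in a finite field *)

(** The [N] nonzero elements are distinct roots of X^N - 1, so one of them is a primitive [N]-th
    root of unity; its power of exponent N / m has order [m]. *)
Lemma finField_prim_root (F : finFieldType) (m : nat) :
  (m %| #|F|.-1)%N -> exists z : F, m.-primitive_root z.
Proof.
set N := #|F|.-1 => mN.
have card_gt1 := finNzRing_gt1 F.
have N_gt0 : (0 < N)%N by rewrite /N -subn1 subn_gt0.
pose rs := enum [pred x : F | x != 0].
have rs1 : all N.-unity_root rs.
  apply/allP => x; rewrite mem_enum inE => x0.
  rewrite unity_rootE; apply/eqP/(mulfI x0).
  by rewrite -exprS mulr1 /N prednK ?expf_card // ltnW.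
have szrs : (N <= size rs)%N by rewrite -cardE (cardC1 (0 : F)).
have /hasP[z _ zP] := has_prim_root N_gt0 rs1 (enum_uniq _) szrs.
by exists (z ^+ (N %/ m)); apply: dvdn_prim_root.
Qed.

(** A geometric sum of ratio [z ^+ m]: times [z ^+ m - 1] it gives [z ^+ (m * n) - 1 = 0], so it
    vanishes unless the ratio is 1. *)
Lemma prim_root_expr_sum (R : idomainType) (n : nat) (z : R) (m : nat) :
  n.-primitive_root z ->
  \sum_(i < n) (z ^+ i) ^+ m = if (n %| m)%N then n%:R else 0.
Proof.
move=> zP; under eq_bigr => i _ do rewrite exprAC.
rewrite (prim_order_dvd zP); case: eqP => [-> | /eqP zm1].
  under eq_bigr => i _ do rewrite expr1n.
  by rewrite sumr_const card_ord.
apply/eqP; have/eqP := subrX1 (z ^+ m) n.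
by rewrite exprAC (prim_expr_order zP) expr1n subrr eq_sym mulf_eq0 subr_eq0
           (negPf zm1).
Qed.

(** * Codes given by a generator matrix *)

Section RowCode.

Variables (F : finFieldType) (k n : nat) (G : 'M[F]_(k, n)).

Definition row_code : {vspace 'rV[F]_n} := limg (linfun (mulmxr G)).

Lemma row_codeP (a : 'rV[F]_n) :
  reflect (exists u : 'rV_k, a = u *m G) (a \in row_code).
Proof.
apply: (iffP memv_imgP) => [[u _ ->]|[u ->]]; exists u => //.
- by rewrite lfunE.
- exact: memvf.
- by rewrite lfunE.
Qed.

Lemma dim_row_code : row_free G -> \dim row_code = k.
Proof.
move=> freeG; rewrite limg_dim_eq ?dimvf /dim /= ?mul1n //.
apply/eqP; rewrite -subv0; apply/subvP => u; rewrite memv_cap => /andP[_].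
rewrite memv_ker lfunE /= mulmx_free_eq0 // => /eqP ->; exact: mem0v.
Qed.

(** [G *m G^T = 0] puts the row space of [G] inside [kermx G^T]; both have rank k = 2k - k, so they
    coincide. *)
Lemma row_code_self_dual :
  n = k.*2 -> row_free G -> G *m G^T = 0 -> self_dual row_code.
Proof.
move=> n2k freeG GG0.
have kerG : (G :=: kermx G^T)%MS.
  apply/eqmxP; rewrite -(mxrank_leqif_eq _); last exact/sub_kermxP.
  by rewrite mxrank_ker mxrank_tr (eqP freeG) n2k -addnn addnK.
have dotE (a b : 'rV[F]_n) : \sum_i a 0 i * b 0 i = (b *m a^T) 0 0.
  by rewrite mxE; apply: eq_bigr => i _; rewrite mxE mulrC.
apply/vspaceP => b; apply/row_codeP/mem_dual_code => [[u ->] a|orth].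
  move=> /row_codeP[w ->]; rewrite dotE trmx_mul mulmxA -(mulmxA u).
  by rewrite GG0 mulmx0 mul0mx mxE.
apply/submxP; rewrite kerG; apply/sub_kermxP/rowP => j.
rewrite [RHS]mxE -[RHS](orth (row j G)); last first.
  by apply/row_codeP; exists (delta_mx 0 j); rewrite rowE.
by rewrite dotE !mxE; apply: eq_bigr => i _; rewrite !mxE.
Qed.

End RowCode.

(** * Evaluation codes at roots of unity *)

Lemma prim_root_expr_inj (R : nzRingType) (n : nat) (z : R) :
  n.-primitive_root z -> injective (fun i : 'I_n => z ^+ i).
Proof.
move=> zP i j /eqP; rewrite (eq_prim_root_expr zP) !modn_small // => /eqP.
exact: val_inj.
Qed.

Lemma card_prim_root_zeros (R : idomainType) (n : nat) (z : R) (p : {poly R}) :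
  n.-primitive_root z -> p != 0 ->
  (#|[set i : 'I_n | p.[z ^+ i] == 0%R]| < size p)%N.
Proof.
move=> zP p0; set A := [set i | _].
pose rs := [seq z ^+ i | i : 'I_n in A].
have <- : size rs = #|A| by rewrite size_map -cardE.
apply: max_poly_roots p0 _ _.
  by apply/allP => _ /mapP[i + ->]; rewrite mem_enum inE.
rewrite map_inj_uniq ?enum_uniq //; exact: prim_root_expr_inj.
Qed.

Section EvaluationCode.

Variables (F : finFieldType) (k : nat) (g : F).
Variables (v : nat -> F) (b : nat -> {poly F}).

Let comb (u : 'rV[F]_k) : {poly F} := \sum_j u 0 j *: b j.

Hypotheses (k_gt0 : (0 < k)%N) (gP : (k.*2).-primitive_root g).
Hypotheses (v_neq0 : forall i, v i != 0).
Hypothesis size_b : forall j : 'I_k, (size (b j) <= k.+1)%N.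
Hypothesis free_b : forall u, comb u = 0 -> u = 0.
Hypothesis orth_b : forall j l : 'I_k,
  \sum_(i < k.*2) v i ^+ 2 * (b j * b l).[g ^+ i] = 0.

(** The nonzero column multipliers [v i] leave all weights unchanged but enter orthogonality through
    their squares, as in [orth_b]. *)
Let G : 'M[F]_(k, k.*2) := \matrix_(j, i) (v i * (b j).[g ^+ i]).

Let mul_GE u i : (u *m G) 0 i = v i * (comb u).[g ^+ i].
Proof.
rewrite mxE horner_sum mulr_sumr; apply: eq_bigr => j _.
by rewrite mxE hornerZ mulrCA.
Qed.

Let weight u : #|[set i | (u *m G) 0 i != 0]| =
  (k.*2 - #|[set i : 'I_(k.*2) | (comb u).[g ^+ i] == 0%R]|)%N.
Proof.
set Z := [set i | (comb u).[_] == 0].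
have := cardsC Z; rewrite card_ord => cardZ.
suff -> : [set i | (u *m G) 0 i != 0] = ~: Z by lia.
apply/setP => i.
by rewrite !inE mul_GE mulf_eq0 (negPf (v_neq0 i)).
Qed.

Let size_comb u : (size (comb u) <= k.+1)%N.
Proof.
apply: (leq_trans (size_sum _ _ _)); apply/bigmax_leqP => j _.
exact: leq_trans (size_scale_leq _ _) _.
Qed.

Let weight_geq (u : 'rV[F]_k) :
  u != 0 -> (k <= #|[set i | ((u *m G) 0 i != 0)%R]|)%N.
Proof.
move=> u0; rewrite weight.
have c0 : comb u != 0 by apply: contraNneq u0 => /free_b ->.
have := leq_trans (card_prim_root_zeros gP c0) (size_comb u); rewrite ltnS.
by move=> /(leq_sub2l k.*2); rewrite -[X in (X - k)%N]addnn addnK.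
Qed.

(** A nonzero [u] killed by [G] would give a word of weight 0, below the bound [k] of
    [weight_geq]. *)
Let free_G : row_free G.
Proof.
rewrite -kermx_eq0; apply/rowV0P => u /sub_kermxP uG.
apply: contraTeq k_gt0 => /weight_geq; rewrite uG -leqNgt => /leq_trans -> //.
by rewrite leqn0 cards_eq0; apply/eqP/setP => i; rewrite !inE mxE eqxx.
Qed.

Let GG0 : G *m G^T = 0.
Proof.
apply/matrixP => j l; rewrite mxE [RHS]mxE -[RHS](orth_b j l).
by apply: eq_bigr => i _; rewrite !mxE hornerM mulrACA -expr2.
Qed.

(** The word of [u] has [k] distinct zeros listed by [s], so it attains the bound of [weight_geq]
    and the distance is exactly [k]. Since the code is its own dual, AMDS then gives NMDS. *)
Lemma evaluation_code_NMDS_self_dual (u : 'rV[F]_k) (s : 'I_k -> 'I_(k.*2)) :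
  u != 0 -> injective s -> (forall j, (comb u).[g ^+ s j] = 0) ->
  exists C : {vspace 'rV[F]_(k.*2)}, NMDS C /\ self_dual C.
Proof.
move=> u0 s_inj us0; exists (row_code G).
have sd : self_dual (row_code G) by apply: row_code_self_dual.
suff amds : AMDS (row_code G) by split; rewrite // /NMDS -sd.
exists k, k; split; last by rewrite -addnn addnK.
split; first exact: dim_row_code.
have dist u1 u2 : hamming_dist (u1 *m G) (u2 *m G)
    = #|[set i | ((u1 - u2) *m G) 0 i != 0]|.
  by apply: eq_card => i; rewrite !inE mulmxBl !mxE subr_eq0.
split; last first.
  move=> _ _ /row_codeP[u1 ->] /row_codeP[u2 ->] u12; rewrite dist.
  by apply: weight_geq; apply: contraNneq u12 => /subr0_eq ->.
exists (u *m G), (0 *m G); split; try by apply/row_codeP; eexists.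
  by rewrite mul0mx mulmx_free_eq0.
rewrite dist subr0; apply/eqP; rewrite eqn_leq weight_geq // andbT weight.
suff : (k <= #|[set i : 'I_(k.*2) | (comb u).[g ^+ i] == 0%R]|)%N by lia.
rewrite -[leqLHS]card_ord -(card_codom s_inj); apply: subset_leq_card.
by apply/subsetP => _ /codomP[j ->]; rewrite inE us0.
Qed.

End EvaluationCode.

(** * The two families of polynomials *)

Lemma NMDS_self_dual_square_roots (F : finFieldType) (k : nat) (h : F) :
  (1 < k)%N -> (k.*2.*2).-primitive_root h ->
  exists C : {vspace 'rV[F]_(k.*2)}, NMDS C /\ self_dual C.
Proof.
move=> k1 hP; pose g := h ^+ 2.
have gP : (k.*2).-primitive_root g.
  have n2n : (k.*2 %| k.*2.*2)%N by rewrite -[X in (_ %| X)%N]mul2n dvdn_mull.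
  have := dvdn_prim_root hP n2n.
  by rewrite -[X in (X %/ _)%N]mul2n mulnK // double_gt0 ltnW.
have h0 : h != 0 by rewrite (prim_root_eq0 hP); lia.
(* The exponent k - 1 is skipped because (k - 1) + k + 1 = 2k is where the power sum would not
   vanish. *)
pose e j := if j == k.-1 then k else j.
pose b j : {poly F} := 'X^(e j).
have kpP : (k.-1 < k)%N by lia.
pose j0 := Ordinal (ltnW k1); pose j1 := Ordinal kpP.
have sP (j : 'I_k) : (j.*2 < k.*2)%N by rewrite ltn_double.
(* The even powers of [g] are the [k]-th roots of unity, the zeros of [comb u = X^k - 1]; [j0] and
   [j1] index 1 and X^k. *)
pose s (j : 'I_k) := Ordinal (sP j).
pose u : 'rV[F]_k := delta_mx 0 j1 - delta_mx 0 j0.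
have j10 : (j0 == j1) = false by apply/eqP => /(congr1 val) /=; lia.
apply: (@evaluation_code_NMDS_self_dual F k g (fun i => h ^+ i) b
          _ _ _ _ _ _ u s).
- exact: ltnW.
- exact: gP.
- by move=> i; rewrite expf_neq0.
- by move=> j; rewrite size_polyXn ltnS /e; case: ifP => // _; apply: ltnW.
- move=> w w0; apply/rowP => j; rewrite mxE.
  have /(congr1 (fun p : {poly F} => p`_(e j))) := w0.
  rewrite coef_sum coef0 (bigD1 j) //= big1 => [|l lj].
    by rewrite addr0 coefZ coefXn eqxx mulr1.
  rewrite coefZ coefXn; case: eqP; rewrite ?mulr0 // => ejl.
  case/eqP: lj; apply: val_inj; move: ejl (ltn_ord j) (ltn_ord l).
  by rewrite /e /=; do 2 case: eqP => ?; lia.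
- move=> j l.
  rewrite -[RHS](_ : \sum_(i < k.*2) (g ^+ i) ^+ (e j + e l).+1 = 0).
    apply: eq_bigr => i _ /=; rewrite exprAC -/g.
    by rewrite hornerM !hornerXn -exprD -exprS.
  (* The exponent lies between 1 and 2k + 1, so 2k is the only multiple to exclude. *)
  rewrite (prim_root_expr_sum _ gP) ifF //; apply/negP => /dvdnP[c].
  move: (ltn_ord j) (ltn_ord l); rewrite /e.
  by do 2 case: eqP => ?; case: c => [|[|c]]; lia.
- apply/eqP => /rowP/(_ j0)/eqP; rewrite !mxE !eqxx j10 sub0r oppr_eq0.
  by rewrite oner_eq0.
- by move=> i j /(congr1 val) /= /double_inj; apply: val_inj.
- move=> j; rewrite (bigD1 j1) //= (bigD1 j0) ?j10 //= big1 => [|l].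
    rewrite !mxE !eqxx j10 eq_sym j10 /b /e eqxx ifF; last by lia.
    rewrite addr0 subr0 sub0r scale1r expr0 scaleN1r !hornerE.
    rewrite -exprM (_ : (j.*2 * k = k.*2 * j)%N); last by lia.
    by rewrite exprM (prim_expr_order gP) expr1n subrr.
  by case/andP => l1 l0; rewrite !mxE /= (negPf l0) (negPf l1) subrr scale0r.
Qed.

Lemma NMDS_self_dual_even (F : finFieldType) (k : nat) (g : F) :
  (0 < k)%N -> ~~ odd k -> (k.*2).-primitive_root g ->
  exists C : {vspace 'rV[F]_(k.*2)}, NMDS C /\ self_dual C.
Proof.
case: k => // k _ k_even gP; set K := k.+1 in gP *.
have g0 : g != 0 by rewrite (prim_root_eq0 gP).
(* The exponent is 0 + 1 + .. + (K - 1), from the product of the roots of [f] below. *)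
pose P := g ^+ 'C(K, 2); pose eta := P^-1.
have P0 : P != 0 by rewrite expf_neq0.
have gK : g ^+ K = -1.
  have /eqP := prim_expr_order gP; rewrite -muln2 exprM sqrf_eq1.
  case/orP; last by move/eqP.
  by rewrite -(prim_order_dvd gP) => /dvdn_leq; rewrite /K; lia.
have P2 : P ^+ 2 = -1.
  rewrite -exprM bin2 muln2 even_halfK; last by rewrite /K oddM (negPf k_even).
  by rewrite exprM gK -signr_odd -[odd _]negbK -oddS (negPf k_even) expr1.
have eta2 : eta ^+ 2 = -1 by rewrite exprVn P2 invrN1.
pose b j : {poly F} := if j == 0%N then 1 + eta *: 'X^K else 'X^j.
pose f := \prod_(j < K) ('X - (g ^+ j)%:P).
have size_f : size f = K.+1.
  by rewrite size_prod_XsubC /index_enum -enumT size_enum_ord.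
have fK : f`_K = 1.
  have : f \is monic by apply: monic_prod_XsubC.
  by rewrite monicE lead_coefE size_f => /eqP.
have f0 : f`_0 = P.
  rewrite -horner_coef0 horner_prod.
  under eq_bigr => j _ do rewrite hornerXsubC sub0r.
  rewrite prodrN card_ord -signr_odd (negPf k_even) expr0 mul1r prodrXr.
  by rewrite -(big_mkord xpredT id) bin2_sum.
pose u : 'rV[F]_K := \row_j f`_j.
(* Below degree [K] the [b l] look like monomials, so the low coefficients of a combination are its
   coordinates. *)
have coef_b (j l : 'I_K) : (b l)`_j = (j == l)%:R.
  rewrite /b; case: eqP => l0; rewrite !coefE //.
  by rewrite (ltn_eqF (ltn_ord j)) mulr0 addr0 -val_eqE /= l0.
have KK : (K <= K.*2)%N by rewrite -addnn leq_addr.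
apply: (@evaluation_code_NMDS_self_dual F K g (fun=> 1) b
          _ _ _ _ _ _ u (widen_ord KK)).
- by [].
- exact: gP.
- by move=> _; apply: oner_neq0.
- move=> j; rewrite /b; case: eqP => _.
    apply: (leq_trans (size_polyD _ _)); rewrite geq_max size_poly1 /=.
    by apply: (leq_trans (size_scale_leq _ _)); rewrite size_polyXn.
  by rewrite size_polyXn ltnW // ltnS.
- move=> w w0; apply/rowP => j; rewrite mxE.
  have /(congr1 (fun p : {poly F} => p`_j)) := w0.
  rewrite coef_sum coef0 (bigD1 j) //= big1 => [|l lj].
    by rewrite addr0 coefZ coef_b eqxx mulr1.
  by rewrite coefZ coef_b eq_sym (negPf lj) mulr0.
- have S m := prim_root_expr_sum m gP.
  have S0 m : (0 < m < K.*2)%N -> \sum_(i < K.*2) (g ^+ i) ^+ m = 0.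
    by move=> /andP[m0 mK]; rewrite S gtnNdvd.
  have S1 l : (0 < l < K)%N ->
      \sum_(i < K.*2) (1 + eta *: 'X^K).[g ^+ i] * (g ^+ i) ^+ l = 0.
    move=> lK; under eq_bigr => i _.
      by rewrite !hornerE mulrDl mul1r -mulrA -exprD; over.
    by rewrite big_split -mulr_sumr /= !S0 ?mulr0 ?addr0 //; lia.
  move=> j l; have lK := ltn_ord l; have jK := ltn_ord j.
  under eq_bigr => i _ do rewrite expr1n mul1r hornerM.
  rewrite /b; have [_|j0] := eqVneq (j : nat) 0%N;
    have [_|l0] := eqVneq (l : nat) 0%N.
  (* At a 2K-th root of unity, (1 + eta X^K)^2 reduces to 2 eta X^K, since eta^2 X^(2K) = -1 cancels
     the 1. *)
  + under eq_bigr => i _.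
      have y2 : (eta * (g ^+ i) ^+ K) ^+ 2 = -1.
        by rewrite exprMn eta2 -!exprM -mulnA muln2 mulnC
                   exprM (prim_expr_order gP) expr1n mulr1.
      rewrite !hornerE -expr2 sqrrD expr1n y2 mul1r addrAC subrr add0r.
      by rewrite -mulrnAl; over.
    by rewrite -mulr_sumr S0 ?mulr0 // /K; lia.
  + under eq_bigr => i _ do rewrite hornerXn.
    by rewrite S1 //; lia.
  + under eq_bigr => i _ do rewrite hornerXn mulrC.
    by rewrite S1 //; lia.
  + under eq_bigr => i _ do rewrite !hornerXn -exprD.
    by rewrite S0 //; lia.
- apply/eqP => /rowP/(_ ord0)/eqP; rewrite !mxE /= f0.
  by rewrite (negPf P0).
- by move=> i j /(congr1 val) /= ij; apply: val_inj.
- move=> j; rewrite (_ : \sum_j _ = f).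
    by rewrite /f (bigD1 j) //= hornerM hornerXsubC subrr mul0r.
  (* The extreme terms of [f] are P and X^K, and P + X^K = P (1 + eta X^K) is the contribution of
     [b 0]. *)
  rewrite -[RHS]coefK size_f poly_def big_ord_recl [RHS]big_ord_recr /=.
  rewrite [in RHS]big_ord_recl /= addrAC.
  under eq_bigr => i _ do rewrite mxE.
  by congr (_ + _); rewrite mxE /b /= f0 fK scalerDr scalerA divff.
Qed.

Theorem theorem3p3 (q n : nat) (F : finFieldType)
    (q_odd : odd q) (q_pp : prime_power q) (card_F : #|F| = q)
    (n_gt0 : (0 < n)%N) (n_even : ~~ odd n) (n_neq2 : n <> 2)
    (n_dvd : (n %| q - 1)%N) (n_lt : (n < q - 1)%N) (q_mod4 : q = 1 %[mod 4]) :
  exists C : {vspace 'rV[F]_n}, NMDS C /\ self_dual C.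
Proof.
have qN : #|F|.-1 = (q - 1)%N by rewrite card_F subn1.
have nk : n = n./2.*2 by rewrite even_halfK.
rewrite nk in n_gt0 n_neq2 n_dvd *; set k := n./2 in n_gt0 n_neq2 n_dvd *.
have [k_odd|k_even] := boolP (odd k).
  have [|h hP] := @finField_prim_root F k.*2.*2.
    (* The coprime numbers 4 and [k] both divide q - 1, hence so does 4k. *)
    have -> : k.*2.*2 = (2 ^ 2 * k)%N by lia.
    rewrite qN Gauss_dvd; last by rewrite coprime_pexpl // coprime2n.
    rewrite (dvdn_trans _ n_dvd : k %| _)%N -?muln2 ?dvdn_mulr // andbT.
    by rewrite -eqn_mod_dvd; [apply/eqP | lia].
  (* Here [n_neq2] provides k > 1. *)
  by apply: NMDS_self_dual_square_roots hP; lia.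
have [|g gP] := @finField_prim_root F k.*2; first by rewrite qN.
by apply: NMDS_self_dual_even gP; lia.
Qed.
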